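(* Let $G$ and $H$ be totally disconnected locally compact groups, $\phi:G\to G$ and $\psi:H\to H$ topological automorphisms. Then $h_{top}(\phi\times \psi)=h_{top}(\phi)+h_{top}(\psi)$.
   Context: For a totally disconnected locally compact group $G$, $\mathcal B(G)$ denotes the family of all open compact subgroups of $G$. A topological automorphism is a group automorphism that is a homeomorphism. For a continuous endomorphism $\eta:G\to G$, $U\in\mathcal B(G)$ and an integer $n\ge 1$, put $C_n(\eta,U)=U\cap\eta^{-1}(U)\cap\ldots\cap\eta^{-n+1}(U)$; the index $[U:C_n(\eta,U)]$ is finite. The topological entropy of $\eta$ with respect to $U$ is $H_{top}(\eta,U)=\lim_{n\to\infty}\frac{\log[U:C_n(\eta,U)]}{n}$ (the limit exists), and the topological entropy of $\eta$ is $h_{top}(\eta)=\sup\{H_{top}(\eta,U):U\in\mathcal B(G)\}\in[0,\infty]$. The map $\phi\times\psi:G\times H\to G\times H$ is $(g,h)\mapsto(\phi(g),\psi(h))$, where $G\times H$ has the product topology; sums are taken in $[0,\infty]$. *)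

(* Defs.v *)
From HB Require Import structures.
From mathcomp Require Import all_boot all_order all_algebra.
From mathcomp Require Import finmap.
From mathcomp Require Import all_classical all_reals all_analysis.

Set Implicit Arguments.
Unset Strict Implicit.
Unset Printing Implicit Defensive.

Import Order.TTheory GRing.Theory Num.Theory.
Import numFieldNormedType.Exports.

Local Open Scope classical_set_scope.
Local Open Scope group_scope.

HB.mixin Record isTopologicalGroup G of Topological G & Group G := {
  mulg_continuous : continuous (fun x : G * G => x.1 * x.2) ;
  invg_continuous : continuous (fun x : G => x^-1)
}.

#[short(type="topologicalGroupType")]
HB.structure Definition TopologicalGroup :=
  {G of Topological G & Group G & isTopologicalGroup G}.

Section ProductGroup.
Variables G H : topologicalGroupType.

Lemma pair_mulg_continuous :
  continuous (fun x : (G * H) * (G * H) => x.1 * x.2).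
Proof.
move=> x; apply: cvg_pair => /=.
- apply: (@continuous_comp _ _ _
    (fun y : (G * H) * (G * H) => (y.1.1, y.2.1)) (fun z : G * G => z.1 * z.2)).
  + apply: cvg_pair => /=.
    * by apply: (@continuous_comp _ _ _ fst fst); exact: cvg_fst.
    * by apply: (@continuous_comp _ _ _ snd fst); [exact: cvg_snd|exact: cvg_fst].
  + exact: mulg_continuous.
- apply: (@continuous_comp _ _ _
    (fun y : (G * H) * (G * H) => (y.1.2, y.2.2)) (fun z : H * H => z.1 * z.2)).
  + apply: cvg_pair => /=.
    * by apply: (@continuous_comp _ _ _ fst snd); [exact: cvg_fst|exact: cvg_snd].
    * by apply: (@continuous_comp _ _ _ snd snd); exact: cvg_snd.
  + exact: mulg_continuous.
Qed.

Lemma pair_invg_continuous : continuous (fun x : G * H => x^-1).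
Proof.
move=> x; apply: cvg_pair => /=.
- apply: (@continuous_comp _ _ _ fst (fun z : G => z^-1)); first exact: cvg_fst.
  exact: invg_continuous.
- apply: (@continuous_comp _ _ _ snd (fun z : H => z^-1)); first exact: cvg_snd.
  exact: invg_continuous.
Qed.

HB.instance Definition _ := isTopologicalGroup.Build (G * H)%type
  pair_mulg_continuous pair_invg_continuous.

End ProductGroup.

Definition homeomorphism (T U : topologicalType) (f : T -> U) :=
  continuous f /\ exists g : U -> T, [/\ continuous g, cancel f g & cancel g f].

Definition topological_automorphism (G : topologicalGroupType) (f : G -> G) :=
  {morph f : x y / x * y} /\ homeomorphism f.

Definition prod_fun (S T S' T' : Type) (f : S -> S') (g : T -> T')
  (x : S * T) : S' * T' := (f x.1, g x.2).

Definition open_compact_subgroups (G : topologicalGroupType) : set (set G) :=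
  [set U | [/\ group_closed [in U], open U & compact U]].
Arguments open_compact_subgroups G : clear implicits.

Section Entropy.
Variables (R : realType) (G : topologicalGroupType).
Implicit Types (eta : G -> G) (U V : set G).

Definition left_cosets U V : set (set G) :=
  [set [set u * v | v in V] | u in U].

(* [U : V]; the value is 0 when there are infinitely many cosets, as
   [fset_set] is empty on infinite sets. *)
Definition subgroup_index U V : nat := #|` fset_set (left_cosets U V)|%fset.

Definition cotrajectory eta U (n : nat) : set G :=
  \bigcap_(i in `I_n) (iter i eta @^-1` U).

(* The term of index 0, where the cotrajectory is [setT], has no influence on
   the limit. *)
Definition Htop eta U : R :=
  limn (fun n => ln (subgroup_index U (cotrajectory eta U n))%:R / n%:R)%R.

(* By van Dantzig's theorem the supremum is over a nonempty set when [G] is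
   totally disconnected and locally compact, so it lies in [0, +oo]. *)
Definition htop eta : \bar R :=
  ereal_sup [set (Htop eta U)%:E | U in open_compact_subgroups G].

End Entropy.

(* Main.v *)
From HB Require Import structures.
From mathcomp Require Import all_boot all_order all_algebra.
From mathcomp Require Import finmap.
Require Import Defs.
From mathcomp Require Import all_classical all_reals all_analysis.

(** Write [C n] for the [n]-th cotrajectory of an open compact subgroup [U]
    under [eta], and [a n] for the index [U : C n].

    The limit that defines the entropy exists because the indices
    [C n : C n.+1] = [a n.+1] / [a n] decrease: [eta] maps [C n.+1] into [C n]
    and pulls the condition that separates [C n] from [C n.+1] back to the one
    that separates [C n.+1] from [C n.+2], while an index can only drop along
    such a preimage ([cotrajectory_ratio_le]).  So the increments of [ln (a n)]
    converge, and [ln (a n) / n] is their Cesaro mean ([is_cvg_Htop]).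

    Entropy is antitone in the subgroup: if [U] is contained in [V] then
    [V : C n of V] <= [V : C n of U] = [V : U] * [U : C n of U], and the
    constant factor [V : U] disappears after taking logarithms and dividing by
    [n] ([Htop_le]).

    On a product subgroup the cotrajectories and the indices are products, so
    the entropies relative to [U] and [V] add up ([Htop_setX]).  Every open
    compact subgroup [W] of the product contains the product of its traces on
    the two factors, and these traces are open compact subgroups again
    ([open_compact_subgroups_retract]).  By antitonicity the supremum over all
    [W] is the supremum over the subgroups [U `*` V], and the supremum of a sum
    over independent indices is the sum of the suprema. *)

Set Implicit Arguments.
Unset Strict Implicit.
Unset Printing Implicit Defensive.
Import Order.TTheory GRing.Theory Num.Theory.
Import numFieldNormedType.Exports.
Local Open Scope classical_set_scope.
Local Open Scope group_scope.
Local Open Scope card_scope.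

(** * Cardinals of finite sets *)

(** Both images are projections, injective by hypothesis, of the set of pairs
    [(f x, g x)]. *)
Lemma card_image_same_fibers (T U V : Type) (A : set T) (f : T -> U)
    (g : T -> V) :
  (forall x y, A x -> A y -> f x = f y <-> g x = g y) ->
  f @` A #= g @` A.
Proof.
move=> fg; pose S := (fun x => (f x, g x)) @` A.
have -> : f @` A = fst @` S by rewrite image_comp.
have -> : g @` A = snd @` S by rewrite image_comp.
have fst_inj : {in S &, injective fst}.
  move=> _ _ /set_mem[x Ax <-] /set_mem[y Ay <-] /= fxy.
  by rewrite fxy (fg x y Ax Ay).1.
have snd_inj : {in S &, injective snd}.
  move=> _ _ /set_mem[x Ax <-] /set_mem[y Ay <-] /= gxy.
  by rewrite gxy (fg x y Ax Ay).2.
by rewrite (card_eql (inj_card_eq fst_inj)) card_eq_sym; exact: inj_card_eq.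
Qed.

Lemma card_le_fset_set (T U : choiceType) (A : set T) (B : set U) :
  finite_set B -> A #<= B -> (#|` fset_set A| <= #|` fset_set B|)%N.
Proof.
move=> /finite_setP[n Bn] AB; rewrite (card_fset_set Bn).
by apply: geq_card_fset_set; rewrite -(card_le_eqr Bn).
Qed.

Lemma card_eq_fset_set (T U : choiceType) (A : set T) (B : set U) :
  finite_set B -> A #= B -> #|` fset_set A| = #|` fset_set B|.
Proof.
move=> /finite_setP[n Bn] AB; rewrite (card_fset_set Bn).
by apply: card_fset_set; exact: card_eq_trans Bn.
Qed.

Lemma card_fset_setX (T U : choiceType) (A : set T) (B : set U) :
  finite_set A -> finite_set B ->
  #|` fset_set (A `*` B)| = (#|` fset_set A| * #|` fset_set B|)%N.
Proof.
move=> finA finB; rewrite fset_setX//.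
rewrite -(size_allpairs (fun x y => (x, y))).
apply/perm_size/uniq_perm; first exact: fset_uniq.
  by apply: allpairs_uniq => //; move=> [? ?] [? ?].
move=> [x y]; rewrite in_fsetM /=.
apply/andP/allpairsP => [[xA yB]|[[x' y'] /= [x'A y'B [-> ->]]]//].
by exists (x, y).
Qed.

(** * Subgroups and indices *)

Local Notation subgroup U := (group_closed [in U]).

Section Index.
Variable G : topologicalGroupType.
Implicit Types A B C U V X : set G.

Lemma subgroupP U :
  subgroup U <-> U 1 /\ (forall x y, U x -> U y -> U (x / y)).
Proof.
split=> [[/set_mem U1 UD]|[U1 UD]].
  by split=> // x y Ux Uy; apply/set_mem/(UD x y); exact/mem_set.
by split; [exact/mem_set|move=> x y /set_mem Ux /set_mem Uy; exact/mem_set/UD].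
Qed.

Lemma subgroup1 U : subgroup U -> U 1.
Proof. by case/subgroupP. Qed.

Lemma subgroupV U x : subgroup U -> U x -> U x^-1.
Proof. by case/subgroupP => U1 UD Ux; rewrite -div1g; exact: UD. Qed.

Lemma subgroupM U x y : subgroup U -> U x -> U y -> U (x * y).
Proof.
move=> gU Ux Uy; rewrite -(invgK y).
by case/subgroupP : (gU) => _; apply => //; exact: subgroupV.
Qed.

Lemma subgroupI U V : subgroup U -> subgroup V -> subgroup (U `&` V).
Proof.
move=> /subgroupP[U1 UD] /subgroupP[V1 VD]; apply/subgroupP; split=> //.
by move=> x y [Ux Vx] [Uy Vy]; split; [exact: UD|exact: VD].
Qed.

Lemma lcoset_eqP U x y : subgroup U ->
  [set x * v | v in U] = [set y * v | v in U] <-> U (x^-1 * y).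
Proof.
move=> gU; split=> [xUyU|Uxy].
  have : [set y * v | v in U] y by exists 1; [exact: subgroup1|rewrite mulg1].
  by rewrite -xUyU => -[v Uv <-]; rewrite mulKg.
rewrite predeqE => z; split=> -[v Uv <-].
  exists ((x^-1 * y)^-1 * v); first by apply: subgroupM => //; exact: subgroupV.
  by rewrite invgM invgK mulgA mulVKg.
by exists (x^-1 * y * v); [exact: subgroupM|rewrite !mulgA mulgV mul1g].
Qed.

(** The tool for every index computation below: the cosets of [B] met by [A] may
    be counted through any function on [A] that separates exactly these cosets. *)
Lemma left_cosets_card (T : Type) (f : G -> T) A B : subgroup B ->
  (forall x y, A x -> A y -> f x = f y <-> B (x^-1 * y)) ->
  left_cosets A B #= f @` A.
Proof.
move=> gB fB; apply: card_image_same_fibers => x y Ax Ay.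
by rewrite lcoset_eqP// fB.
Qed.

Lemma left_cosetsI A B : subgroup A -> subgroup B ->
  left_cosets A (A `&` B) #= left_cosets A B.
Proof.
move=> gA gB; apply: left_cosets_card; first exact: subgroupI.
move=> x y Ax Ay; rewrite lcoset_eqP//; split=> [Bxy|[]//].
by split=> //; apply: subgroupM => //; exact: subgroupV.
Qed.

Lemma open_translate x U : open U -> open ((fun y => x * y) @^-1` U).
Proof.
apply: open_comp => y _.
apply: (@continuous_comp _ _ _ (fun z : G => (x, z)) (fun z => z.1 * z.2)).
  by apply: cvg_pair => /=; [exact: cvg_cst|exact: cvg_id].
exact: mulg_continuous.
Qed.

(** The cosets of [B] form an open cover of [A]. *)
Lemma finite_left_cosets A B : open B -> subgroup B -> compact A ->
  finite_set (left_cosets A B).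
Proof.
move=> oB gB.
pose T : ptopologicalType :=
  HB.pack (G : Type) (Topological.class G) (isPointed.Build G (1 : G)).
rewrite (compact_cover T) => /(_ G A (fun x => [set x * v | v in B])).
case.
- move=> x _.
  have -> : [set x * v | v in B] = (fun y => x^-1 * y) @^-1` B.
    rewrite predeqE => y; split=> [[v Bv <-]|By]; first by rewrite /= mulKg.
    by exists (x^-1 * y); rewrite ?mulVKg.
  exact: open_translate.
- move=> x Ax; exists x => //; exists 1; [exact: subgroup1|exact: mulg1].
move=> D DA covD.
apply: (@sub_finite_set _ _ ((fun x => [set x * v | v in B]) @` [set` D])).
  move=> _ [x Ax <-]; have [d Dd [v Bv dvx]] := covD x Ax.
  by exists d => //; apply/lcoset_eqP => //; rewrite -dvx mulKg.
exact/finite_image/finite_fset.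
Qed.

Lemma index_gt0 A B : A 1 -> finite_set (left_cosets A B) ->
  (0 < subgroup_index A B)%N.
Proof.
move=> A1 fin; rewrite cardfs_gt0; apply/fset0Pn.
by exists [set 1 * v | v in B]; rewrite in_fset_set//; apply/mem_set; exists 1.
Qed.

Lemma index_subset A B : A 1 -> subgroup B -> A `<=` B ->
  subgroup_index A B = 1%N.
Proof.
move=> A1 gB AB; rewrite -(cardfs1 tt) -fset_set1.
apply: card_eq_fset_set; first exact: finite_set1.
have -> : [set tt] = (fun=> tt) @` A.
  by rewrite predeqE => -[]; split=> // _; exists 1.
apply: left_cosets_card => // x y Ax Ay; split=> // _.
by apply: subgroupM => //; [apply: subgroupV => //|]; exact: AB.
Qed.

(** Fix a representative [r S] in each coset [S] of [B].  Sending [x] to the pair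
    formed by its coset [x B] and the coset [r (x B)^-1 x C] separates exactly the
    cosets of [C], and it reaches every pair. *)
Lemma index_tower A B C : subgroup A -> subgroup B -> subgroup C ->
  C `<=` B -> B `<=` A -> finite_set (left_cosets A B) ->
  finite_set (left_cosets B C) ->
  subgroup_index A C = (subgroup_index A B * subgroup_index B C)%N.
Proof.
move=> gA gB gC CB BA finAB finBC.
rewrite /subgroup_index -card_fset_setX//.
apply: card_eq_fset_set; first exact: finite_setX.
pose cB x := [set x * v | v in B]; pose cC x := [set x * v | v in C].
pose r (S : set G) := xget 1 S.
have rB x : exists2 b, B b & r (cB x) = x * b.
  have : cB x (r (cB x)).
    by apply: xgetPex; exists x; exists 1; [exact: subgroup1|exact: mulg1].
  by case=> b Bb <-; exists b.
pose f x := (cB x, cC ((r (cB x))^-1 * x)).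
have -> : left_cosets A B `*` left_cosets B C = f @` A.
  rewrite predeqE => -[S S']; split=> /=.
  - move=> [[a Aa <-] [b Bb <-]].
    (* The representative of [a B] times [b] is a preimage of the pair. *)
    have [b' Bb' rab'] := rB a.
    have eqB : cB (r (cB a) * b) = cB a.
      apply/lcoset_eqP => //; rewrite rab' !invgM -!mulgA mulVg mulg1.
      by apply: subgroupM => //; exact: subgroupV.
    exists (r (cB a) * b); last by rewrite /f eqB mulKg.
    rewrite rab'; do 2 (apply: subgroupM => //; last exact: BA).
  - move=> [x Ax [<- <-]]; split; first by exists x.
    exists ((r (cB x))^-1 * x) => //.
    have [b Bb ->] := rB x; rewrite invgM -mulgA mulVg mulg1.
    exact: subgroupV.
apply: left_cosets_card => // x y Ax Ay; split.
- move=> [] /[dup] /lcoset_eqP - /(_ gB) Bxy -> /lcoset_eqP - /(_ gC).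
  by rewrite invgM invgK -mulgA mulVKg.
- move=> Cxy; have eqB : cB x = cB y by apply/lcoset_eqP => //; exact: CB.
  rewrite /f eqB; congr pair; apply/lcoset_eqP => //.
  by rewrite invgM invgK -mulgA mulVKg.
Qed.

(** The complement is a union of cosets, which are open. *)
Lemma open_subgroup_closed U : open U -> subgroup U -> closed U.
Proof.
move=> oU gU; rewrite -[U]setCK; apply: open_closedC.
have -> : ~` U = \bigcup_(x in ~` U) ((fun y => x^-1 * y) @^-1` U).
  rewrite predeqE => y; split=> [nUy|[x nUx /= Uxy Uy]].
    by exists y => //=; rewrite mulVg; exact: subgroup1.
  apply: nUx; have -> : x = y * (x^-1 * y)^-1 by rewrite invgM invgK mulVKg.
  by apply: subgroupM => //; exact: subgroupV.
by apply: bigcup_open => x _; exact: open_translate.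
Qed.
End Index.

(** * Preimages under morphisms *)

Section Morphism.
Variables (G H : topologicalGroupType) (eta : G -> H).
Hypothesis etaM : {morph eta : x y / x * y}.

Lemma morph_group1 : eta 1 = 1.
Proof. by apply: (mulgI (eta 1)); rewrite -etaM !mulg1. Qed.

Lemma morph_groupV : {morph eta : x / x^-1}.
Proof.
by move=> x; apply: (mulgI (eta x)); rewrite -etaM !mulgV morph_group1.
Qed.

Lemma subgroup_preimage (U : set H) : subgroup U -> subgroup (eta @^-1` U).
Proof.
move=> /subgroupP[U1 UD]; apply/subgroupP; split.
  by rewrite /= morph_group1.
by move=> x y Ux Uy /=; rewrite etaM morph_groupV; exact: UD.
Qed.

(** The coset of [x] modulo the preimage of [B] is determined by the coset of
    [eta x] modulo [B]. *)
Lemma index_preimage_le (A : set G) (A' B : set H) : subgroup B ->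
  A `<=` eta @^-1` A' -> finite_set (left_cosets A' B) ->
  (subgroup_index A (eta @^-1` B) <= subgroup_index A' B)%N.
Proof.
move=> gB AA' fin; apply: card_le_fset_set => //.
have/card_le_eql -> : left_cosets A (eta @^-1` B) #=
    (fun x => [set eta x * v | v in B]) @` A.
  apply: left_cosets_card; first exact: subgroup_preimage.
  by move=> x y _ _; rewrite lcoset_eqP//= etaM morph_groupV.
by apply: subset_card_le => _ [x Ax <-]; exists (eta x) => //; exact: AA'.
Qed.
End Morphism.

(** [i] makes [G] a retract of [K] with retraction [p], so [i @^-1` W] lies in
    the compact set [p @` W], where it is closed since it is an open subgroup. *)
Lemma open_compact_subgroups_retract (G K : topologicalGroupType)
    (i : G -> K) (p : K -> G) (W : set K) :
  {morph i : x y / x * y} -> continuous i -> continuous p -> cancel i p ->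
  open_compact_subgroups K W -> open_compact_subgroups G (i @^-1` W).
Proof.
move=> iM iC pC ipK [gW oW cW].
have gU : subgroup (i @^-1` W) by exact: subgroup_preimage.
have oU : open (i @^-1` W) by apply: open_comp.
split=> //; apply: (@subclosed_compact _ _ (p @` W)).
- exact: open_subgroup_closed.
- by apply: continuous_compact => //; exact: continuous_subspaceT.
- by move=> x Wix; exists (i x).
Qed.

(** * Cotrajectories *)

Section Cotrajectory.
Variables (G : topologicalGroupType) (eta : G -> G).
Hypotheses (etaM : {morph eta : x y / x * y}) (etaC : continuous eta).
Implicit Types U V : set G.

Lemma iter_morph n : {morph iter n eta : x y / x * y}.
Proof. by elim: n => [//|n IH] x y /=; rewrite IH etaM. Qed.

Lemma iter_continuous n : continuous (iter n eta).
Proof.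
elim: n => [|n IH] x; first exact: cvg_id.
by apply: (@continuous_comp _ _ _ (iter n eta) eta); [exact: IH|exact: etaC].
Qed.

Lemma open_preimage_iter n U : open U -> open (iter n eta @^-1` U).
Proof. by move=> oU; apply: open_comp => // x _; exact: iter_continuous. Qed.

Lemma cotrajectory0 U : cotrajectory eta U 0 = setT.
Proof. by rewrite predeqE => x; split=> // _ i. Qed.

Lemma cotrajectorySr U n :
  cotrajectory eta U n.+1 = cotrajectory eta U n `&` (iter n eta @^-1` U).
Proof.
rewrite predeqE => x; split=> [Cx|[Cx Ux] i /=].
  by split=> [i /= lt_in|]; apply: Cx => //=; exact: ltnW.
by rewrite ltnS leq_eqVlt => /predU1P[->//|]; exact: Cx.
Qed.

Lemma cotrajectoryS_sub U n :
  cotrajectory eta U n.+1 `<=` eta @^-1` (cotrajectory eta U n).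
Proof. by move=> x Cx i /= lt_in; rewrite -iterSr; exact: (Cx i.+1). Qed.

Lemma cotrajectory_sub U n : cotrajectory eta U n.+1 `<=` U.
Proof. by move=> x Cx; exact: (Cx 0%N). Qed.

Lemma cotrajectory_mono U V n : U `<=` V ->
  cotrajectory eta U n `<=` cotrajectory eta V n.
Proof. by move=> UV x Cx i /= lt_in; exact/UV/Cx. Qed.

Lemma cotrajectory_subgroup U n : subgroup U -> subgroup (cotrajectory eta U n).
Proof.
move=> /subgroupP[U1 UD]; apply/subgroupP; split=> [i _|x y Cx Cy i lt_in] /=.
  by rewrite (morph_group1 (@iter_morph i)).
rewrite iter_morph (morph_groupV (@iter_morph i)).
by apply: UD; [exact: Cx|exact: Cy].
Qed.

Lemma open_cotrajectory U n : open U -> open (cotrajectory eta U n).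
Proof.
move=> oU; elim: n => [|n IH]; first by rewrite cotrajectory0; exact: openT.
by rewrite cotrajectorySr; apply: openI => //; exact: open_preimage_iter.
Qed.

Definition cotrajectory_index U n := subgroup_index U (cotrajectory eta U n).

Section OpenCompact.
Variable U : set G.
Hypothesis BU : open_compact_subgroups G U.
Let C := cotrajectory eta U.

Let gU : subgroup U. Proof. by case: BU. Qed.
Let oU : open U. Proof. by case: BU. Qed.
Let cU : compact U. Proof. by case: BU. Qed.
Let gC n : subgroup (C n). Proof. exact: cotrajectory_subgroup. Qed.
Let oC n : open (C n). Proof. exact: open_cotrajectory. Qed.

Lemma compact_cotrajectory n : compact (C n.+1).
Proof.
apply: (subclosed_compact _ cU) => //; last exact: cotrajectory_sub.
exact: open_subgroup_closed.
Qed.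

Lemma finite_cotrajectory_cosets V n : open_compact_subgroups G V ->
  finite_set (left_cosets V (C n)).
Proof. by case=> *; exact: finite_left_cosets. Qed.

Lemma cotrajectory_index_gt0 n : (0 < cotrajectory_index U n)%N.
Proof.
by apply: index_gt0; [exact: subgroup1|exact: finite_cotrajectory_cosets].
Qed.

Lemma cotrajectory_index0 : cotrajectory_index U 0 = 1%N.
Proof. by apply: index_subset; [exact: subgroup1| |rewrite cotrajectory0]. Qed.

(** This is the index [C n.+1 : C n.+2], since [C n.+2] is the intersection of
    [C n.+1] with [iter n.+1 eta @^-1` U].  Counting cosets of the larger group is
    what makes preimages under [eta] easy to compare.  The index starts at 1
    because [C 0] is the whole group. *)
Definition cotrajectory_ratio n :=
  subgroup_index (C n.+1) (iter n.+1 eta @^-1` U).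

Let finX n : finite_set (left_cosets (C n.+1) (iter n.+1 eta @^-1` U)).
Proof.
apply: finite_left_cosets; first exact: open_preimage_iter.
  exact/subgroup_preimage/gU/iter_morph.
exact: compact_cotrajectory.
Qed.

Lemma cotrajectory_indexS n :
  cotrajectory_index U n.+2 =
  (cotrajectory_index U n.+1 * cotrajectory_ratio n)%N.
Proof.
rewrite /cotrajectory_index (@index_tower _ U (C n.+1) (C n.+2))//.
- congr muln; apply: card_eq_fset_set => //.
  rewrite /C [cotrajectory _ _ n.+2]cotrajectorySr; apply: left_cosetsI => //.
  exact/subgroup_preimage/gU/iter_morph.
- by rewrite /C [cotrajectory _ _ n.+2]cotrajectorySr => x [].
- exact: cotrajectory_sub.
- exact: finite_cotrajectory_cosets.
- by apply: finite_left_cosets => //; exact: compact_cotrajectory.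
Qed.

(** [eta] maps [C n.+2] into [C n.+1], and [iter n.+2 eta @^-1` U] is the preimage
    under [eta] of [iter n.+1 eta @^-1` U]. *)
Lemma cotrajectory_ratio_le n :
  (cotrajectory_ratio n.+1 <= cotrajectory_ratio n)%N.
Proof.
rewrite /cotrajectory_ratio.
have -> : iter n.+2 eta @^-1` U = eta @^-1` (iter n.+1 eta @^-1` U).
  by rewrite predeqE => x; rewrite /= -!iterS iterSr.
apply: index_preimage_le => //; first exact/subgroup_preimage/gU/iter_morph.
exact: cotrajectoryS_sub.
Qed.

Lemma cotrajectory_ratio_gt0 n : (0 < cotrajectory_ratio n)%N.
Proof. by apply: index_gt0 => //; exact: subgroup1. Qed.

End OpenCompact.
End Cotrajectory.

(** * Entropy relative to a subgroup *)

Section Entropy.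
Variables (R : realType) (G : topologicalGroupType) (eta : G -> G).
Hypotheses (etaM : {morph eta : x y / x * y}) (etaC : continuous eta).
Implicit Types U V : set G.
Local Open Scope ring_scope.

(** The increments of [v n = ln (a n)] are nonnegative and, from the second one
    on, nonincreasing. *)
Lemma is_cvg_Htop U : open_compact_subgroups G U ->
  cvgn (fun n => ln (cotrajectory_index eta U n)%:R / n%:R : R).
Proof.
move=> BU; pose v n : R := ln (cotrajectory_index eta U n)%:R.
have v0 : v 0%N = 0 by rewrite /v cotrajectory_index0// ln1.
have telv n : telescope v n.+1 = ln (cotrajectory_ratio eta U n)%:R.
  rewrite /telescope /= /v cotrajectory_indexS// natrM lnM ?posrE ?ltr0n.
  - by rewrite addrC addKr.
  - exact: cotrajectory_index_gt0.
  - exact: cotrajectory_ratio_gt0.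
have : cvgn [sequence telescope v n.+1]_n.
  apply: nonincreasing_is_cvgn.
    apply/nonincreasing_seqP => n.
    rewrite /= [leLHS]telv [leRHS]telv ler_ln ?posrE ?ltr0n//.
    - by rewrite ler_nat; exact: cotrajectory_ratio_le.
    - exact: cotrajectory_ratio_gt0.
    - exact: cotrajectory_ratio_gt0.
  exists 0 => _ [n _ <-]; rewrite [leRHS]telv ln_ge0// ler1n.
  exact: cotrajectory_ratio_gt0.
rewrite cvg_shiftS => /cesaro; set l := lim _ => mean_cvg.
apply/cvg_ex; exists l; rewrite -cvg_shiftS.
rewrite (_ : [sequence _]_n = arithmetic_mean (telescope v))//.
by apply/funext => n; rewrite /arithmetic_mean telescopeK /= v0 subr0 mulrC.
Qed.

(** Both cotrajectory indices are compared with [V : C n of U], which is at least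
    [V : C n of V] and equals [V : U] * [U : C n of U]. *)
Lemma Htop_le U V : open_compact_subgroups G U -> open_compact_subgroups G V ->
  U `<=` V -> Htop R eta V <= Htop R eta U.
Proof.
move=> BU BV UV; have [gU oU cU] := BU; have [gV oV cV] := BV.
have finVU : finite_set (left_cosets V U) by exact: finite_left_cosets.
pose c : R := ln (subgroup_index V U)%:R.
have c_cvg : (fun n => c / n%:R) @ \oo --> 0.
  have := cvgMl_tmp (a := c) cvg_harmonic; rewrite mulr0 => c_cvg.
  by rewrite -cvg_shiftS; exact: c_cvg.
rewrite -[leRHS]add0r -(cvg_lim _ c_cvg)// -limD; last 2 first.
- by apply/cvg_ex; exists 0.
- exact: is_cvg_Htop.
apply: ler_lim; [exact: is_cvg_Htop|apply: is_cvgD|].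
- by apply/cvg_ex; exists 0.
- exact: is_cvg_Htop.
(* For [n] = 0 the cotrajectory is the whole group and need not lie in [V]. *)
exists 1%N => // -[//|n] _; rewrite [leRHS]/GRing.add /=.
rewrite -mulrDl ler_pM2r ?invr_gt0// -lnM ?posrE ?ltr0n; last 2 first.
- by apply: index_gt0 => //; exact: subgroup1.
- exact: cotrajectory_index_gt0.
have gC W m : subgroup W -> subgroup (cotrajectory eta W m).
  exact: cotrajectory_subgroup.
have finC m W : open_compact_subgroups G W ->
    finite_set (left_cosets W (cotrajectory eta U m)).
  exact: finite_cotrajectory_cosets.
have finC' m : finite_set (left_cosets (cotrajectory eta V m.+1)
    (cotrajectory eta U m.+1)).
  apply: finite_left_cosets; first exact: open_cotrajectory.
    exact: gC.
  exact: compact_cotrajectory.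
rewrite ler_ln ?posrE -?natrM ?ltr0n; last 2 first.
- exact: cotrajectory_index_gt0.
- rewrite muln_gt0 cotrajectory_index_gt0// andbT.
  by apply: index_gt0 => //; exact: subgroup1.
rewrite ler_nat /cotrajectory_index -index_tower//; last 3 first.
- exact: gC.
- exact: cotrajectory_sub.
- exact: finC.
rewrite (@index_tower _ V (cotrajectory eta V n.+1) (cotrajectory eta U n.+1))//.
- by rewrite leq_pmulr//; apply: index_gt0 => //; exact: subgroup1 (gC _ _ gV).
- exact: gC.
- exact: gC.
- exact: cotrajectory_mono.
- exact: cotrajectory_sub.
- exact: finite_cotrajectory_cosets.
Qed.

End Entropy.

(** * Products *)

Section Product.
Variables (R : realType) (G H : topologicalGroupType).

Lemma subgroup_setX (U : set G) (V : set H) :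
  subgroup U -> subgroup V -> subgroup (U `*` V).
Proof.
move=> /subgroupP[U1 UD] /subgroupP[V1 VD]; apply/subgroupP; split=> //.
by move=> [x x'] [y y'] [/= Ux Vx] [/= Uy Vy]; split; [exact: UD|exact: VD].
Qed.

Lemma open_setX (U : set G) (V : set H) : open U -> open V -> open (U `*` V).
Proof.
move=> oU oV.
have -> : U `*` V = (fst @^-1` U) `&` (snd @^-1` V) by [].
by apply: openI; apply: open_comp => // x _; [exact: cvg_fst|exact: cvg_snd].
Qed.

Lemma open_compact_subgroups_setX (U : set G) (V : set H) :
  open_compact_subgroups G U -> open_compact_subgroups H V ->
  open_compact_subgroups (G * H)%type (U `*` V).
Proof.
move=> [gU oU cU] [gV oV cV].
by split; [exact: subgroup_setX|exact: open_setX|exact: compact_setX].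
Qed.

Lemma index_setX (A B : set G) (A' B' : set H) : subgroup B -> subgroup B' ->
  finite_set (left_cosets A B) -> finite_set (left_cosets A' B') ->
  subgroup_index (A `*` A') (B `*` B') =
  (subgroup_index A B * subgroup_index A' B')%N.
Proof.
move=> gB gB' fin fin'; rewrite /subgroup_index -card_fset_setX//.
apply: card_eq_fset_set; first exact: finite_setX.
pose f (x : G * H) := ([set x.1 * v | v in B], [set x.2 * v | v in B']).
have -> : left_cosets A B `*` left_cosets A' B' = f @` (A `*` A').
  rewrite predeqE => -[S S']; split=> /=.
    by move=> [[x Ax <-] [x' Ax' <-]]; exists (x, x').
  by move=> [[x x'] [/= Ax Ax'] [<- <-]]; split; [exists x|exists x'].
apply: left_cosets_card => [|[x x'] [y y'] _ _]; first exact: subgroup_setX.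
split=> [[/lcoset_eqP Bxy /lcoset_eqP Bxy']|[/= Bxy Bxy']].
  by split; [exact: Bxy|exact: Bxy'].
by congr pair; exact/lcoset_eqP.
Qed.

Variables (phi : G -> G) (psi : H -> H).

Lemma cotrajectory_setX U V n :
  cotrajectory (prod_fun phi psi) (U `*` V) n =
  cotrajectory phi U n `*` cotrajectory psi V n.
Proof.
have it i x : iter i (prod_fun phi psi) x = (iter i phi x.1, iter i psi x.2).
  by elim: i => [|i /= ->]; rewrite -?surjective_pairing.
rewrite predeqE => x; split=> [Cx|[Cx Cx'] i lt_in]; last first.
  by rewrite /= it; split; [exact: Cx|exact: Cx'].
by split=> i lt_in; have := Cx i lt_in; rewrite /= it => -[].
Qed.

Hypotheses (phiM : {morph phi : x y / x * y}) (phiC : continuous phi).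
Hypotheses (psiM : {morph psi : x y / x * y}) (psiC : continuous psi).

Lemma Htop_setX U V :
  open_compact_subgroups G U -> open_compact_subgroups H V ->
  Htop R (prod_fun phi psi) (U `*` V) = (Htop R phi U + Htop R psi V)%R.
Proof.
move=> BU BV; have [gU _ _] := BU; have [gV _ _] := BV.
rewrite /Htop -limD; [|exact: is_cvg_Htop|exact: is_cvg_Htop].
congr (limn _); apply/funext => n; rewrite [RHS]/GRing.add /=.
rewrite cotrajectory_setX index_setX; last 4 first.
- exact: cotrajectory_subgroup.
- exact: cotrajectory_subgroup.
- exact: finite_cotrajectory_cosets.
- exact: finite_cotrajectory_cosets.
rewrite natrM lnM ?posrE ?ltr0n ?mulrDl//.
- exact: cotrajectory_index_gt0.
- exact: cotrajectory_index_gt0.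
Qed.

End Product.

(** Finiteness of the elements allows subtracting them one at a time.  If one of
    the two sets is empty its supremum is [-oo], which absorbs the other term. *)
Lemma ereal_sup_add_le (R : realType) (A B : set \bar R) (s : \bar R) :
  (forall x, A x -> x \is a fin_num) -> (forall y, B y -> y \is a fin_num) ->
  (forall x y, A x -> B y -> x + y <= s)%E ->
  (ereal_sup A + ereal_sup B <= s)%E.
Proof.
move=> finA finB ABs.
have [->|/set0P[y0 By0]] := eqVneq B set0.
  by rewrite ereal_sup0 addeNy leNye.
have supA y : B y -> (ereal_sup A + y <= s)%E.
  move=> By; rewrite -leeBrDr ?finB//.
  by apply: ge_ereal_sup => x Ax; rewrite leeBrDr ?finB//; exact: ABs.
have [finsA|] := boolP (ereal_sup A \is a fin_num).
  rewrite -leeBrDl//; apply: ge_ereal_sup => y By; rewrite leeBrDl//.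
  exact: supA.
rewrite fin_numE negb_and !negbK => /orP[/eqP->|/eqP supAy].
  by rewrite addNye leNye.
have := supA _ By0; rewrite supAy addye; last first.
  by have /fin_numP[] := finB _ By0.
by rewrite leye_eq => /eqP->; exact: leey.
Qed.

Theorem theorem4p7 (R : realType) (G H : topologicalGroupType)
    (tdG : totally_disconnected [set: G]) (lcG : locally_compact [set: G])
    (tdH : totally_disconnected [set: H]) (lcH : locally_compact [set: H])
    (phi : G -> G) (psi : H -> H)
    (autphi : topological_automorphism phi)
    (autpsi : topological_automorphism psi) :
  (htop R (prod_fun phi psi) = htop R phi + htop R psi)%E.
Proof.
have [phiM [phiC _]] := autphi; have [psiM [psiC _]] := autpsi.
apply/eqP; rewrite eq_le; apply/andP; split.
- apply: ge_ereal_sup => _ [W BW <-].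
  have BU : open_compact_subgroups G [set x | W (x, 1)].
    apply: (open_compact_subgroups_retract (i := fun x => (x, 1))
      (p := fst)) BW.
    + by move=> x y; congr pair; rewrite mul1g.
    + by move=> x; apply: cvg_pair; [exact: cvg_id|exact: cvg_cst].
    + by move=> x; exact: cvg_fst.
    + by [].
  have BV : open_compact_subgroups H [set y | W (1, y)].
    apply: (open_compact_subgroups_retract (i := fun y => (1, y))
      (p := snd)) BW.
    + by move=> x y; congr pair; rewrite mul1g.
    + by move=> x; apply: cvg_pair; [exact: cvg_cst|exact: cvg_id].
    + by move=> x; exact: cvg_snd.
    + by [].
  have leH : (Htop R (prod_fun phi psi) W <= Htop R (prod_fun phi psi)
      ([set x | W (x, 1%g)] `*` [set y | W (1%g, y)]))%R.
    apply: Htop_le => //.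
    + by move=> x y; congr pair; [exact: phiM|exact: psiM].
    + move=> x; apply: cvg_pair.
        by apply: (@continuous_comp _ _ _ fst phi); [exact: cvg_fst|exact: phiC].
      by apply: (@continuous_comp _ _ _ snd psi); [exact: cvg_snd|exact: psiC].
    + exact: open_compact_subgroups_setX.
    + move=> [x y] [/= Wx Wy].
      have -> : (x, y) = (x, 1 : H) * (1 : G, y) by congr pair; rewrite ?mulg1 ?mul1g.
      by apply: subgroupM => //; case: BW.
  rewrite Htop_setX// in leH; apply: (@le_trans _ _ (_ + _)%R%:E).
    by rewrite lee_fin; exact: leH.
  rewrite EFinD; apply: leeD; apply: ereal_sup_ubound.
    by eexists; first exact: BU.
  by eexists; first exact: BV.
- apply: ereal_sup_add_le => [_ [U _ <-]//|_ [V _ <-]//|].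
  move=> _ _ [U BU <-] [V BV <-]; rewrite -EFinD -Htop_setX//.
  apply: ereal_sup_ubound; exists (U `*` V) => //.
  exact: open_compact_subgroups_setX.
Qed.
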